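(* Let $\mathcal{X}\subseteq\mathbb{R}^n$ be nonempty, closed and convex, $a_0\in\mathbb{R}^n$, let $\mathcal{V}\subset\mathbb{R}^n$ be compact, smooth and strictly convex with $0\in\mathrm{int}(\mathcal{V})$, and let $\varphi(\cdot)=g(\|\cdot\|_{\mathcal{V}^{\circ}})$, where $g:\mathbb{R}\to[0,\infty)$ is Legendre with $g(0)=0$ and $g'(0)=0$; assume the Bregman projection induced by $\varphi$ is $\kappa$-expansive. Let $x_0\in\mathcal{X}$, and let $\{x_k\}=\{x_k:k\in[0,K]\}$ be the proximal path induced by $\varphi$, initialized at $x_0$ and associated with a step-size sequence $\{\lambda_k>0\}$ with $\sum_{k=0}^{\infty}\lambda_k^{-1}=\infty$. Put $\upsilon=\omega^{-1}$ and let $\{x_{\mathrm{CP}}(\upsilon^{-1};x_0):\upsilon\in[0,\infty)\}$ be the central path induced by $\varphi$ and initialized at $x_0$. Assume that both $\{x_k\}$ and $\{x_{\mathrm{CP}}(\upsilon^{-1};x_0)\}$ are contained in $\bigcup_{i\in[I]}\mathrm{ri}(\mathcal{F}_i)$, where $\mathcal{F}_i$, $i\in[I]=\{1,\dots,I\}$, are (distinct) faces of $\mathcal{X}$. For every $i\in[I]$ define $$\mathcal{K}^{(i)}=\left[\underline{k}^{(i)},\overline{k}^{(i)}\right]=\{k\in[0,K]:x_k\in\mathrm{ri}(\mathcal{F}_i)\},\qquad \Upsilon^{(i)}=\left[\underline{\upsilon}^{(i)},\overline{\upsilon}^{(i)}\right]=\{\upsilon\in[0,\infty):x_{\mathrm{CP}}(\upsilon^{-1};x_0)\in\mathrm{ri}(\mathcal{F}_i)\},$$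 so that $\{x_k:k\in\mathcal{K}^{(i)}\}_{i\in[I]}$ and $\{x_{\mathrm{CP}}(\upsilon^{-1};x_0):\upsilon\in\Upsilon^{(i)}\}_{i\in[I]}$ form partitions of $\{x_k\}$ and $\{x_{\mathrm{CP}}(\upsilon^{-1};x_0)\}$ respectively. Then for each $i\in[I]$, $$D_\varphi\left(x_k,x_{\mathrm{CP}}(\upsilon_k^{-1};x_0)\right)\le\kappa\cdot D_\varphi\left(x_{\mathrm{CP}}\left((\underline{\upsilon}^{(i)})^{-1};x_0\right),x_{\underline{k}^{(i)}}\right)\qquad\forall k\in\left[\underline{k}^{(i)}+1,\overline{k}^{(i)}\right],$$ where $\upsilon_k=\underline{\upsilon}^{(i)}+\sum_{j=\underline{k}^{(i)}}^{k-1}\lambda_j^{-1}$.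
   Context: For a closed convex set $\mathcal{C}\subseteq\mathbb{R}^n$ containing $0$: the gauge is $\|v\|_{\mathcal{C}}=\inf\{t\ge0: v\in t\mathcal{C}\}$ and the polar is $\mathcal{C}^{\circ}=\{y:\langle x,y\rangle\le1\ \forall x\in\mathcal{C}\}$. A convex set with nonempty interior is strictly convex if for distinct boundary points the open segment between them lies in the interior; it is smooth if the supporting hyperplane at each boundary point is unique. $\mathrm{ri}$ denotes relative interior. A proper closed convex function $\psi:\mathbb{R}^n\to\mathbb{R}\cup\{+\infty\}$ is Legendre if $\mathrm{int}(\mathrm{dom}\,\psi)\ne\varnothing$, $\psi$ is differentiable and strictly convex on $\mathrm{int}(\mathrm{dom}\,\psi)$, and $\|\nabla\psi(x_n)\|_2\to\infty$ whenever $x_n\in\mathrm{int}(\mathrm{dom}\,\psi)$ converges to a boundary point of $\mathrm{dom}\,\psi$. Bregman divergence: $D_\varphi(x,y)=\varphi(x)-\varphi(y)-\langle\nabla\varphi(y),x-y\rangle$. Bregman projection onto a closed convex set $\mathcal{S}$: $\Pi^{\varphi}_{\mathcal{S}}(y)=\arg\min_{x\in\mathcal{S}}D_\varphi(x,y)$. The Bregman projection induced by $\varphi$ is $\kappa$-expansive if for every (nonempty) closed convex $\mathcal{S}$ and all $x,y\in\mathrm{int}(\mathrm{dom}\,\varphi)$, $D_\varphi(\Pi^\varphi_{\mathcal{S}}(x),\Pi^\varphi_{\mathcal{S}}(y))\le\kappa D_\varphi(x,y)$, and in addition, with $d=y-x$, $D_\varphi(\Pi^\varphi_{\mathcal{S}+d}(x),\Pi^\varphi_{\mathcal{S}}(x))\le\kappa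 D_\varphi(x,y)$. Proximal path: $x_{k+1}=\arg\min_{x\in\mathcal{X}}\langle a_0,x\rangle+\lambda_kD_\varphi(x,x_k)$. Central path initialized at $x_0$: $x_{\mathrm{CP}}(\omega;x_0)=\arg\min_{x\in\mathcal{X}}\langle a_0,x\rangle+\omega D_\varphi(x,x_0)$; equivalently $x_{\mathrm{CP}}(\upsilon^{-1};x_0)=\arg\min_{x\in\mathcal{X}}\upsilon\langle a_0,x\rangle+D_\varphi(x,x_0)$, which for $\upsilon=0$ is understood to be $x_0$. These minimizers are taken to exist (they are then unique by strict convexity). Intervals of indices $k$ are integer intervals. The sets $\mathcal{K}^{(i)}$ and $\Upsilon^{(i)}$ are taken to be nonempty intervals; $\underline{k}^{(i)},\overline{k}^{(i)}$ denote the first and last element of $\mathcal{K}^{(i)}$, and $\underline{\upsilon}^{(i)},\overline{\upsilon}^{(i)}$ denote the infimum and supremum of $\Upsilon^{(i)}$ (with $\overline{\upsilon}^{(i)}=+\infty$ allowed). *)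

(* Defs.v *)
(* R^n is 'rV[R]_n, whose library norm is the sup norm;
   that norm is used only for the topology, and the Euclidean inner product and
   norm are [dot] and [norm2] below. *)
From HB Require Import structures.
From mathcomp Require Import all_boot all_order all_algebra.
From mathcomp Require Import all_classical all_reals all_analysis.
Set Implicit Arguments.
Unset Strict Implicit.
Unset Printing Implicit Defensive.
Import Order.TTheory GRing.Theory Num.Theory.
Import numFieldNormedType.Exports.
Local Open Scope classical_set_scope.
Local Open Scope ring_scope.

Section Definitions.
Context {R : realType} {n : nat}.
Implicit Types (A C F S X : set 'rV[R]_n) (x y p : 'rV[R]_n).

Definition dot x y : R := \sum_(i < n) x 0 i * y 0 i.

Definition norm2 x : R := Num.sqrt (dot x x).

Definition grad (f : 'rV[R]_n -> R) x : 'rV[R]_n :=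
  \row_(i < n) 'D_(delta_mx 0 i) f x.

Definition boundary A : set 'rV[R]_n := closure A `\` A°.

Definition affine_set A :=
  forall x y (t : R), A x -> A y -> A ((1 - t) *: x + t *: y).

Definition affine_hull A : set 'rV[R]_n := smallest affine_set A.

Definition relint A : set 'rV[R]_n :=
  [set x | A x /\ \forall y \near x, affine_hull A y -> A y].

Definition is_face X F :=
  [/\ convex_set F, F `<=` X &
      forall x y (t : R), X x -> X y -> 0 < t < 1 ->
        F ((1 - t) *: x + t *: y) -> F x /\ F y].

(* The infimum is that of the reals, hence the intended one only when v lies in
   some t C.  This is always so if 0 is interior to C, in particular if C is
   the polar of a bounded set. *)
Definition gauge C (v : 'rV[R]_n) : R :=
  inf [set t : R | 0 <= t /\ [set t *: x | x in C] v].

Definition polar C : set 'rV[R]_n := [set y | forall x, C x -> dot x y <= 1].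

Definition strictly_convex_set C :=
  [/\ convex_set C, C° !=set0 &
      forall x y (t : R), boundary C x -> boundary C y -> x != y ->
        0 < t < 1 -> C° ((1 - t) *: x + t *: y)].

Definition supporting_hyperplane C x (H : set 'rV[R]_n) :=
  exists p, [/\ p != 0, H = [set z | dot p z = dot p x] &
                forall z, C z -> dot p z <= dot p x].

(* Existence of a supporting hyperplane at a boundary point holds for every
   convex set, so only its uniqueness is stated. *)
Definition smooth_set C :=
  [/\ convex_set C, C° !=set0 &
      forall x, boundary C x -> is_subset1 (supporting_hyperplane C x)].

Definition dom (psi : 'rV[R]_n -> \bar R) : set 'rV[R]_n :=
  [set x | (psi x < +oo)%E].

Definition proper_fun (psi : 'rV[R]_n -> \bar R) :=
  (forall x, psi x != -oo%E) /\ dom psi !=set0.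

(* Meant for functions that never take the value -oo; 0 * +oo = 0 makes the
   endpoints t = 0 and t = 1 harmless. *)
Definition convex_efun (psi : 'rV[R]_n -> \bar R) :=
  forall x y (t : R), 0 <= t <= 1 ->
    (psi ((1 - t) *: x + t *: y)%R
       <= (1 - t)%:E * psi x + t%:E * psi y)%E.

(* For proper functions, closed means lower semicontinuous. *)
Definition legendre (psi : 'rV[R]_n -> \bar R) :=
  [/\ [/\ proper_fun psi, convex_efun psi & lower_semicontinuous psi],
      (dom psi)° !=set0,
      forall x, (dom psi)° x -> differentiable (fine \o psi) x,
      forall x y (t : R), (dom psi)° x -> (dom psi)° y -> x != y ->
        0 < t < 1 ->
        (psi ((1 - t) *: x + t *: y)%R
           < (1 - t)%:E * psi x + t%:E * psi y)%E &
      forall (u : nat -> 'rV[R]_n) (b : 'rV[R]_n),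
        (forall k, (dom psi)° (u k)) -> boundary (dom psi) b ->
        u @ \oo --> b ->
        norm2 (grad (fine \o psi) (u k)) @[k --> \oo] --> +oo].

Definition bregman (phi : 'rV[R]_n -> R) x y : R :=
  phi x - phi y - dot (grad phi y) (x - y).

Definition is_argmin S (f : 'rV[R]_n -> R) x :=
  S x /\ forall z, S z -> f x <= f z.

(* The projection is a relation rather than a function; for strictly convex phi
   a minimizer is unique when it exists. *)
Definition is_bregman_proj (phi : 'rV[R]_n -> R) S y x :=
  is_argmin S (fun z => bregman phi z y) x.

(* phi is finite everywhere, so that int (dom phi) is the whole space and x, y
   are unrestricted. *)
Definition expansive (kappa : R) (phi : 'rV[R]_n -> R) :=
  forall S, S !=set0 -> closed S -> convex_set S ->
  forall x y,
    (forall px py,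
      is_bregman_proj phi S x px -> is_bregman_proj phi S y py ->
      bregman phi px py <= kappa * bregman phi x y) /\
    (forall px px',
      is_bregman_proj phi [set s + (y - x) | s in S] x px ->
      is_bregman_proj phi S x px' ->
      bregman phi px px' <= kappa * bregman phi x y).

Definition is_proximal_path X (phi : 'rV[R]_n -> R) (a0 x0 : 'rV[R]_n)
    (lam : nat -> R) (K : nat) (xs : nat -> 'rV[R]_n) :=
  xs 0%N = x0 /\
  forall k, (k < K)%N ->
    is_argmin X (fun x => dot a0 x + lam k * bregman phi x (xs k)) (xs k.+1).

(* The central path is parametrized by the inverse upsilon of the weight omega
   of the divergence, so that xcp upsilon is x_CP(upsilon^-1; x0).  The value
   at 0 is given apart because 0^-1 = 0 in the library. *)
Definition is_central_path X (phi : 'rV[R]_n -> R) (a0 x0 : 'rV[R]_n)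
    (xcp : R -> 'rV[R]_n) :=
  xcp 0 = x0 /\
  forall ups : R, 0 < ups ->
    is_argmin X (fun x => dot a0 x + ups^-1 * bregman phi x x0) (xcp ups).

End Definitions.

(* Main.v *)
Require Import Defs.
From HB Require Import structures.
From mathcomp Require Import all_boot all_order all_algebra.
From mathcomp Require Import all_classical all_reals all_analysis.
From mathcomp Require Import ring lra.
Import Order.TTheory GRing.Theory Num.Theory.
Import numFieldNormedType.Exports.
Local Open Scope classical_set_scope.
Local Open Scope ring_scope.

(** Write G for [grad phi], D for [bregman phi] and [<.,.>] for [dot].

    The expansiveness condition is applied to singletons S = {s} only.  It then
    says 0 <= kappa D(x, y) and D(s + d, s) <= kappa D(x, x + d) for all s, x, d
    ([expansive_ge0], [expansive_shift]).  When kappa <= 0 this makes phi lie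
    below its tangent planes, and a nonnegative function can do so only if it
    is constant, so that D vanishes ([bregman_eq0_of_le0]).  When kappa > 0,
    phi lies above its tangent planes, and the second condition says that the
    increments of G in a fixed direction are comparable with factor kappa, at
    whatever points they are taken.  Cutting a segment into many equal pieces
    turns this into a bound on the curvature: every direction u has a number
    mu >= 0 with
      mu h <= <G(x + h u) - G(x), u> <= kappa mu h   for all x and h >= 0
    ([curvature_exists]).  So phi is smooth along u, and D(x + t u, x) lies
    between mu t^2 / 2 and kappa mu t^2 / 2.

    These bounds give the first order condition: a minimizer c over X of
    <a, x> + w D(x, b) has G(b) - a / w - G(c) in the normal cone of X at c
    ([argmin_normal]).  A vector normal to X at a relative interior point of a
    face is normal at every point of the face ([normal_on_face]).  Let F be the
    face under consideration, l its first index, k the given index, S the sum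
    of 1 / lam j over l <= j < k, and s the infimum of the set of parameters
    for which the central path c is in the relative interior of F.  Then
    - G(x_l) - S a0 - G(x_k) is normal at x_k, as the sum of the conditions for
      the proximal steps l, ..., k - 1, which all end in F
      ([prox_path_normal]);
    - G(x_0) - s a0 - G(c(s)) is normal at x_k, even when c(s) is not in the
      relative interior of F ([central_path_inf_normal]);
    - G(x_0) - (s + S) a0 - G(c(s + S)) is normal at c(s + S), in whichever
      face this point lies.
    Testing the first two against c(s + S) and the third against x_k, and
    adding, gives
      <G(x_k) - G(c(s + S)), v> <= <G(x_l) - G(c(s)), v>,   v = x_k - c(s + S).

    In the Euclidean case kappa = 1 the Cauchy-Schwarz inequality would
    conclude.  In general its place is taken by the Young-type inequality
    [bregman_young] together with the curvature bounds in the direction v, and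
    the loss is exactly one factor kappa ([bregman_dual_shift]). *)

(** * The Euclidean inner product *)

Lemma dotDl {R : realType} {n : nat} (x y z : 'rV[R]_n) :
  dot (x + y) z = dot x z + dot y z.
Proof.
by rewrite /dot -big_split; apply: eq_bigr => i _; rewrite mxE mulrDl.
Qed.

Lemma dotZl {R : realType} {n : nat} (t : R) (x y : 'rV[R]_n) :
  dot (t *: x) y = t * dot x y.
Proof.
by rewrite /dot mulr_sumr; apply: eq_bigr => i _; rewrite mxE mulrA.
Qed.

Lemma dotC {R : realType} {n : nat} (x y : 'rV[R]_n) : dot x y = dot y x.
Proof. by apply: eq_bigr => i _; rewrite mulrC. Qed.

Lemma dotNl {R : realType} {n : nat} (x y : 'rV[R]_n) :
  dot (- x) y = - dot x y.
Proof. by rewrite -scaleN1r dotZl mulN1r. Qed.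

Lemma dot0l {R : realType} {n : nat} (x : 'rV[R]_n) : dot 0 x = 0.
Proof. by apply: big1 => i _; rewrite mxE mul0r. Qed.

Lemma dotDr {R : realType} {n : nat} (x y z : 'rV[R]_n) :
  dot x (y + z) = dot x y + dot x z.
Proof. by rewrite dotC dotDl !(dotC x). Qed.

Lemma dotZr {R : realType} {n : nat} (t : R) (x y : 'rV[R]_n) :
  dot x (t *: y) = t * dot x y.
Proof. by rewrite dotC dotZl dotC. Qed.

Lemma dotNr {R : realType} {n : nat} (x y : 'rV[R]_n) :
  dot x (- y) = - dot x y.
Proof. by rewrite dotC dotNl dotC. Qed.

Definition dot_linear {R : realType} {n : nat} :=
  (@dotDl R n, @dotDr R n, @dotNl R n, @dotNr R n, @dotZl R n, @dotZr R n).

(** * Subdivision arguments on the real line *)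

Lemma le0_of_quadratic_bound {R : realType} (b M : R) :
  (forall t : R, 0 < t <= 1 -> t * b <= M * t ^+ 2) -> b <= 0.
Proof.
move=> H; rewrite leNgt; apply/negP => b0.
have M1 : 0 < `|M| + 1 + b by have := normr_ge0 M; lra.
pose t := b / (`|M| + 1 + b).
have tM : t * (`|M| + 1 + b) = b by rewrite divfK// gt_eqF.
have t0 : 0 < t by rewrite divr_gt0.
have t1 : t <= 1.
  by rewrite ler_pdivrMr// mul1r; have := normr_ge0 M; lra.
have tH : t * b <= M * t ^+ 2 by apply: H; rewrite t0 t1.
have {}tH : b <= M * t by rewrite -(ler_pM2l t0); move: tH; lra.
have : M * t <= `|M| * t by rewrite ler_pM2r// ler_norm.
by have := mulr_gt0 t0 b0; lra.
Qed.

(** Over N equal steps the increments add up to at most M t^2 / N.  Applied to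
    the difference between a function and a parabola, this integrates a bound
    on the derivative without any differentiability. *)
Lemma le_of_quadratic_increment {R : realType} (e : R -> R) (M : R) :
  (forall t h : R, 0 <= t -> 0 <= h -> e (t + h) - e t <= M * h ^+ 2) ->
  forall t : R, 0 <= t -> e t <= e 0.
Proof.
move=> He t t0; rewrite -subr_le0.
have steps (h : R) N : 0 <= h -> e (N%:R * h) - e 0 <= N%:R * (M * h ^+ 2).
  move=> h0; elim: N => [|N IH]; first by rewrite !mul0r subrr.
  have := He (N%:R * h) h (mulr_ge0 (ler0n _ _) h0) h0.
  rewrite -natr1 !mulrDl !mul1r; lra.
rewrite leNgt; apply/negP => d0; set d := e t - e 0 in d0 *.
have c0 : 0 <= `|M| * t ^+ 2 / d.
  by apply: divr_ge0; [rewrite mulr_ge0 ?sqr_ge0|exact: ltW].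
have := archi_boundP c0; set N := Num.Def.archi_bound _ => NM.
have N0 : 0 < N%:R :> R by exact: le_lt_trans NM.
have {}NM : `|M| * t ^+ 2 < N%:R * d by rewrite -ltr_pdivrMr.
have := steps (t / N%:R) N (divr_ge0 t0 (ltW N0)).
rewrite mulrCA divff ?gt_eqF// mulr1 -/d => dle.
have {}dle : N%:R * d <= M * t ^+ 2.
  have -> : M * t ^+ 2 = N%:R * (N%:R * (M * (t / N%:R) ^+ 2)).
    by field; rewrite gt_eqF.
  by rewrite ler_pM2l.
have : M * t ^+ 2 <= `|M| * t ^+ 2.
  by rewrite ler_wpM2r ?sqr_ge0// ler_norm.
lra.
Qed.

(** Comparability of increments over equal steps gives comparability of the
    difference quotients over steps h and k of different lengths: the fraction
    h / N is used as a common step, and the rest of k that is left over is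
    negligible as N grows. *)
Lemma increment_ratio {R : realType} (f1 f2 : R -> R) (kappa : R) :
  (forall s h : R, 0 <= h -> 0 <= f1 (s + h) - f1 s) ->
  (forall s h : R, 0 <= h -> 0 <= f2 (s + h) - f2 s) ->
  0 <= kappa ->
  (forall s t h : R, 0 < h ->
     f1 (s + h) - f1 s <= kappa * (f2 (t + h) - f2 t)) ->
  forall s t h k : R, 0 < h -> 0 < k ->
    k * (f1 (s + h) - f1 s) <= h * (kappa * (f2 (t + k) - f2 t)).
Proof.
move=> f1_ge0 f2_ge0 kappa0 H s t h k h0 k0.
have step1 (N : nat) (d s' t' : R) : 0 < d ->
    f1 (s' + N%:R * d) - f1 s' <= N%:R * (kappa * (f2 (t' + d) - f2 t')).
  move=> d0; elim: N => [|N IH]; first by rewrite !mul0r addr0 subrr.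
  have := H (s' + N%:R * d) t' d d0.
  rewrite -natr1 !mulrDl !mul1r addrA => incr; lra.
have step2 (N M : nat) (d s' t' : R) : 0 < d ->
    M%:R * (f1 (s' + N%:R * d) - f1 s') <=
    N%:R * (kappa * (f2 (t' + M%:R * d) - f2 t')).
  move=> d0; elim: M => [|M IH].
    by rewrite !mul0r addr0 subrr mulr0 mulr0.
  have := step1 N d s' (t' + M%:R * d) d0.
  rewrite -natr1 !mulrDl !mul1r [t' + (_ + _)]addrA => incr; lra.
set D1 := f1 _ - _; set D2 := f2 _ - _.
have D1_ge0 : 0 <= D1 by apply: f1_ge0; exact: ltW.
have key (N : nat) : (0 < N)%N -> N%:R * (k * D1 - h * (kappa * D2)) <= h * D1.
  move=> N0; have N0' : 0 < N%:R :> R by rewrite ltr0n.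
  pose d := h / N%:R; pose M := Num.Def.truncn (k / d).
  have d0 : 0 < d by rewrite divr_gt0.
  have Nd : N%:R * d = h by rewrite mulrC divfK// gt_eqF.
  have /andP[Mk kM] : M%:R <= k / d < M.+1%:R.
    by apply: truncn_itv; rewrite divr_ge0// ltW.
  have {}Mk : M%:R * d <= k by rewrite -ler_pdivlMr.
  have {}kM : k < M%:R * d + d.
    by move: kM; rewrite ltr_pdivrMr// -natr1 mulrDl mul1r.
  have := step2 N M d s t d0; rewrite Nd -/D1 => MD1.
  have D2M : f2 (t + M%:R * d) - f2 t <= D2.
    have := f2_ge0 (t + M%:R * d) (k - M%:R * d).
    rewrite subr_ge0 => /(_ Mk).
    have -> : t + M%:R * d + (k - M%:R * d) = t + k by ring.
    by rewrite /D2; lra.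
  have {}MD1 : M%:R * D1 <= N%:R * (kappa * D2).
    by apply: le_trans MD1 _; rewrite ler_pM2l// ler_wpM2l.
  (* M D1 <= N kappa D2 is multiplied by h = N d; then M d is replaced with
     k - d, which is smaller. *)
  have e1 : N%:R * ((M%:R * d) * D1) <= h * (N%:R * (kappa * D2)).
    have -> : N%:R * (M%:R * d * D1) = h * (M%:R * D1) by rewrite -Nd; ring.
    by rewrite ler_pM2l.
  have e2 : N%:R * ((k - d) * D1) <= N%:R * (M%:R * d * D1).
    by rewrite ler_pM2l// ler_wpM2r//; lra.
  have e3 : N%:R * (d * D1) = h * D1 by rewrite mulrA Nd.
  lra.
rewrite leNgt -subr_gt0; apply/negP => gap.
have c0 : 0 <= h * D1 / (k * D1 - h * (kappa * D2)).
  by apply: divr_ge0; [rewrite mulr_ge0// ltW|exact: ltW].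
have := archi_boundP c0; set N := Num.Def.archi_bound _.
rewrite ltr_pdivrMr// => lt1.
have := key N; case: (N) lt1 => [|N'] lt1.
  have : 0 <= h * D1 by rewrite mulr_ge0// ltW.
  by move: lt1; rewrite mul0r; lra.
by move=> /(_ isT); lra.
Qed.

(** * Bregman divergences *)

Lemma bregman_sym {R : realType} {n : nat} (phi : 'rV[R]_n -> R)
    (x y : 'rV[R]_n) :
  bregman phi x y + bregman phi y x = dot (grad phi x - grad phi y) (x - y).
Proof. by rewrite /bregman !dot_linear; ring. Qed.

Lemma bregman_three_point {R : realType} {n : nat} (phi : 'rV[R]_n -> R)
    (x y z : 'rV[R]_n) :
  bregman phi z x =
  bregman phi z y + bregman phi y x + dot (grad phi y - grad phi x) (z - y).
Proof. by rewrite /bregman !dot_linear; ring. Qed.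

(** The convex function D(., x) has gradient G(y) - G(x) at y; the inequality
    says that its value at y + v is nonnegative. *)
Lemma bregman_young {R : realType} {n : nat} (phi : 'rV[R]_n -> R)
    (D_ge0 : forall x y : 'rV[R]_n, 0 <= bregman phi x y) (x y v : 'rV[R]_n) :
  dot (grad phi x - grad phi y) v <= bregman phi y x + bregman phi (y + v) y.
Proof.
have := D_ge0 (y + v) x; rewrite (bregman_three_point _ x y) [y + v - y]addrAC
  subrr add0r.
by rewrite !dot_linear; lra.
Qed.

(** The hypothesis is used for d and, with the two end points exchanged, for
    - d; the two instances add up to symmetrized divergences, which are
    increments of the gradient. *)
Lemma grad_increment_le {R : realType} {n : nat} (phi : 'rV[R]_n -> R)
    (kappa : R)
    (D_shift : forall s x d : 'rV[R]_n,
       bregman phi (s + d) s <= kappa * bregman phi x (x + d))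
    (s t d : 'rV[R]_n) :
  dot (grad phi (s + d) - grad phi s) d
  <= kappa * dot (grad phi (t + d) - grad phi t) d.
Proof.
have E z : dot (grad phi (z + d) - grad phi z) d
    = bregman phi (z + d) z + bregman phi z (z + d).
  by rewrite bregman_sym [z + d - z]addrAC subrr add0r.
have := D_shift s t d; have := D_shift (s + d) (t + d) (- d).
by rewrite !addrK !E; lra.
Qed.

(** * Curvature bounds *)

(** For a twice differentiable phi this says that the second derivative of phi
    in the direction u lies everywhere between mu and kappa mu. *)
Definition curvature {R : realType} {n : nat} (phi : 'rV[R]_n -> R)
    (kappa : R) (u : 'rV[R]_n) (mu : R) :=
  forall (x : 'rV[R]_n) (h : R), 0 <= h ->
    mu * h <= dot (grad phi (x + h *: u) - grad phi x) u <= kappa * mu * h.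

Lemma curvatureN {R : realType} {n : nat} (phi : 'rV[R]_n -> R)
    (kappa : R) (u : 'rV[R]_n) (mu : R) :
  curvature phi kappa u mu -> curvature phi kappa (- u) mu.
Proof.
move=> cu x h h0; have := cu (x + h *: - u) h h0.
by rewrite scalerN subrK !dot_linear => /andP[? ?]; apply/andP; split; lra.
Qed.

Definition curved {R : realType} {n : nat} (phi : 'rV[R]_n -> R) (kappa : R) :=
  forall u, exists2 mu : R, 0 <= mu & curvature phi kappa u mu.

(** The infimum of all difference quotients of the gradient along u serves as
    mu, since each of these quotients is at most kappa times any other. *)
Lemma curvature_exists {R : realType} {n : nat} (phi : 'rV[R]_n -> R)
    (kappa : R) (kappa_gt0 : 0 < kappa)
    (D_ge0 : forall x y : 'rV[R]_n, 0 <= bregman phi x y)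
    (D_shift : forall s x d : 'rV[R]_n,
       bregman phi (s + d) s <= kappa * bregman phi x (x + d)) :
  curved phi kappa.
Proof.
move=> u.
pose f (x : 'rV[R]_n) (s : R) := dot (grad phi (x + s *: u)) u.
pose q (x : 'rV[R]_n) (h : R) := dot (grad phi (x + h *: u) - grad phi x) u.
have f_inc (x : 'rV[R]_n) (s h : R) : f x (s + h) - f x s = q (x + s *: u) h.
  by rewrite /f /q scalerDl addrA !dot_linear.
have qE (x : 'rV[R]_n) (h : R) :
  q x h = dot (grad phi (x + h *: u) - grad phi x) u by [].
have hq (x : 'rV[R]_n) (h : R) :
    h * q x h = dot (grad phi (x + h *: u) - grad phi x) (h *: u).
  by rewrite dotZr.
clearbody f q.
have q_ge0 (x : 'rV[R]_n) (h : R) : 0 <= h -> 0 <= q x h.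
  rewrite le_eqVlt => /predU1P[<-|h0].
    by rewrite qE scale0r addr0 subrr dot0l.
  rewrite -(pmulr_rge0 _ h0) hq.
  have -> : h *: u = (x + h *: u) - x by rewrite addrAC subrr add0r.
  by rewrite subrKC -bregman_sym addr_ge0.
have q_ratio (x y : 'rV[R]_n) (h k : R) : 0 < h -> 0 < k ->
    k * q x h <= h * (kappa * q y k).
  move=> h0 k0.
  have f_ge0 z (s l : R) : 0 <= l -> 0 <= f z (s + l) - f z s.
    by move=> l0; rewrite f_inc q_ge0.
  have f_le (s t l : R) : 0 < l ->
      f x (s + l) - f x s <= kappa * (f y (t + l) - f y t).
    move=> l0; rewrite 2!f_inc -(ler_pM2l l0) mulrCA hq hq.
    exact: grad_increment_le.
  have := increment_ratio _ _ _ (f_ge0 x) (f_ge0 y) (ltW kappa_gt0) f_le 0 0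
    _ _ h0 k0.
  by rewrite 2!f_inc scale0r 2!addr0.
pose Q := [set r : R | exists x h, 0 < h /\ r = q x h / h].
have Q0 : Q !=set0 by exists (q 0 1 / 1), 0, 1.
have Qlb : lbound Q 0.
  by move=> _ [x [h [h0 ->]]]; rewrite divr_ge0 ?q_ge0 ?ltW.
exists (inf Q); first exact: lb_le_inf.
move=> x h; rewrite le_eqVlt => /predU1P[<-|h0].
  by rewrite !mulr0 scale0r addr0 subrr dot0l lexx.
apply/andP; split.
  rewrite -qE -ler_pdivlMr//; apply: ge_inf; first by exists 0.
  by exists x, h.
rewrite -qE; have : q x h / (kappa * h) <= inf Q.
  apply: lb_le_inf => // _ [y [k [k0 ->]]].
  rewrite ler_pdivrMr ?mulr_gt0// mulrAC ler_pdivlMr//.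
  by have := q_ratio x y h k h0 k0; lra.
by rewrite ler_pdivrMr ?mulr_gt0//; lra.
Qed.

Lemma bregman_le_curvature {R : realType} {n : nat} (phi : 'rV[R]_n -> R)
    (kappa : R) (D_ge0 : forall x y : 'rV[R]_n, 0 <= bregman phi x y)
    (u : 'rV[R]_n) (mu : R) (cu : curvature phi kappa u mu)
    (x : 'rV[R]_n) (t : R) : 0 <= t ->
  bregman phi (x + t *: u) x <= kappa * mu / 2 * t ^+ 2.
Proof.
pose e (t : R) := bregman phi (x + t *: u) x - kappa * mu / 2 * t ^+ 2.
have e0 : e 0 = 0.
  rewrite /e scale0r addr0 /bregman !subrr dotC dot0l; ring.
move=> t0; rewrite -subr_le0 -[leLHS]/(e t) -e0.
apply: (le_of_quadratic_increment _ (kappa * mu / 2)) => // {t t0} t h t0 h0.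
rewrite /e (bregman_three_point _ x (x + t *: u)).
have /andP[_] := cu x (t + h) (addr_ge0 t0 h0).
have := D_ge0 (x + t *: u) (x + (t + h) *: u).
have := bregman_sym phi (x + t *: u) (x + (t + h) *: u).
have -> : x + (t + h) *: u - (x + t *: u) = h *: u.
  by rewrite opprD addrACA subrr add0r -scalerBl addrC addKr.
have -> : x + t *: u - (x + (t + h) *: u) = - (h *: u).
  by rewrite opprD addrACA subrr add0r -scalerBl opprD addNKr scaleNr.
rewrite !dot_linear => E1 E2 E3.
have := ler_wpM2l h0 E3; lra.
Qed.

Lemma bregman_ge_curvature {R : realType} {n : nat} (phi : 'rV[R]_n -> R)
    (kappa : R) (D_ge0 : forall x y : 'rV[R]_n, 0 <= bregman phi x y)
    (u : 'rV[R]_n) (mu : R) (cu : curvature phi kappa u mu)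
    (x : 'rV[R]_n) (t : R) : 0 <= t ->
  mu / 2 * t ^+ 2 <= bregman phi (x + t *: u) x.
Proof.
pose e (t : R) := mu / 2 * t ^+ 2 - bregman phi (x + t *: u) x.
have e0 : e 0 = 0.
  rewrite /e scale0r addr0 /bregman !subrr dotC dot0l; ring.
move=> t0; rewrite -subr_le0 -[leLHS]/(e t) -e0.
apply: (le_of_quadratic_increment _ (mu / 2)) => // {t t0} t h t0 h0.
rewrite /e (bregman_three_point _ x (x + t *: u) (x + (t + h) *: u)).
have /andP[E3 _] := cu x t t0.
have := D_ge0 (x + (t + h) *: u) (x + t *: u).
have -> : x + (t + h) *: u - (x + t *: u) = h *: u.
  by rewrite opprD addrACA subrr add0r -scalerBl addrC addKr.
rewrite dotZr.
have := ler_wpM2l h0 E3; lra.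
Qed.

(** With v = x' - y', A = D(x', y'), B = D(y', x') and mu the curvature bound
    for v, the hypothesis and the Young-type inequality give
      t (A + B) <= D(y, x) + kappa mu t^2 / 2   for all t >= 0,
    and the best t yields (A + B)^2 <= 2 kappa mu D(y, x).  Now
    (A + B)^2 >= 4 A B and B >= mu / 2, so that mu cancels.  If mu = 0,
    then A is zero as well.

    If x' and y' arise from x and y by one and the same translation of the
    gradients followed by a minimization over a convex set, then monotonicity
    of the normal cone gives the hypothesis. *)
Lemma bregman_dual_shift {R : realType} {n : nat} (phi : 'rV[R]_n -> R)
    (kappa : R) (kappa_gt0 : 0 < kappa)
    (D_ge0 : forall x y : 'rV[R]_n, 0 <= bregman phi x y)
    (phi_curved : curved phi kappa) (x y x' y' : 'rV[R]_n) :
  dot (grad phi x' - grad phi y') (x' - y')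
    <= dot (grad phi x - grad phi y) (x' - y') ->
  bregman phi x' y' <= kappa * bregman phi y x.
Proof.
set u := x' - y' => le_u.
have [mu mu0 cu] := phi_curved u.
have xE : y' + 1 *: u = x' by rewrite scale1r /u subrKC.
have yE : x' + 1 *: - u = y' by rewrite scale1r /u opprB subrKC.
have A1 := bregman_ge_curvature _ _ D_ge0 _ _ cu y' 1 ler01.
have A2 := bregman_le_curvature _ _ D_ge0 _ _ cu y' 1 ler01.
have B1 := bregman_ge_curvature _ _ D_ge0 _ _ (curvatureN _ _ _ _ cu) x' 1
  ler01.
rewrite xE expr1n !mulr1 in A1 A2; rewrite yE expr1n mulr1 in B1.
have yx0 := D_ge0 y x.
move: le_u; rewrite -bregman_sym -/u.
set A := bregman phi x' y' in A1 A2 *; set B := bregman phi y' x' in B1 *.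
move=> AB.
have tAB t : 0 <= t -> t * (A + B) <= bregman phi y x + kappa * mu / 2 * t ^+ 2.
  move=> t0; have := bregman_young _ D_ge0 x y (t *: u).
  have := bregman_le_curvature _ _ D_ge0 _ _ cu y t t0.
  by have := ler_wpM2l t0 AB; rewrite dotZr; lra.
move: mu0; rewrite le_eqVlt => /predU1P[mu0|mu0].
  by have := mulr_ge0 (ltW kappa_gt0) yx0; move: A2; rewrite -mu0; lra.
have km0 : 0 < kappa * mu by rewrite mulr_gt0.
have := tAB ((A + B) / (kappa * mu)).
have AB0 : 0 <= A + B by lra.
move=> /(_ (divr_ge0 AB0 (ltW km0))).
have E : (A + B) / (kappa * mu) * (A + B) =
    kappa * mu * ((A + B) / (kappa * mu)) ^+ 2.
  by field; rewrite !gt_eqF.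
rewrite E => le1.
have {}le1 : kappa * mu * ((A + B) / (kappa * mu)) ^+ 2 <= 2 * bregman phi y x.
  lra.
rewrite -E mulrAC ler_pdivrMr// in le1.
have sq : 2 * (mu * A) <= (A + B) * (A + B).
  have A0 : 0 <= A by lra.
  have := mulr_ge0 A0 (_ : 0 <= B - mu / 2); rewrite subr_ge0 => /(_ B1).
  by have := sqr_ge0 (A - B); lra.
by rewrite -(ler_pM2l mu0); lra.
Qed.

(** * Normal vectors of faces *)

Definition normal_at {R : realType} {n : nat} (X : set 'rV[R]_n)
    (x p : 'rV[R]_n) := forall z, X z -> dot p (z - x) <= 0.

(** Along the segment from c to z the objective exceeds its first order
    expansion by at most a multiple of t^2, thanks to the curvature bound. *)
Lemma argmin_normal {R : realType} {n : nat} (phi : 'rV[R]_n -> R)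
    (kappa : R) (D_ge0 : forall x y : 'rV[R]_n, 0 <= bregman phi x y)
    (phi_curved : curved phi kappa) (X : set 'rV[R]_n)
    (X_convex : convex_set X) (a b c : 'rV[R]_n) (w : R) (w_gt0 : 0 < w) :
  is_argmin X (fun x => dot a x + w * bregman phi x b) c ->
  normal_at X c (grad phi b - w^-1 *: a - grad phi c).
Proof.
move=> [Xc c_min] z Xz; set u := z - c.
have [mu mu0 cu] := phi_curved u.
apply: (le0_of_quadratic_bound _ (kappa * mu / 2)) => t /andP[t0 t1].
have Xt : X (c + t *: u).
  have := X_convex z c (Itv01 (ltW t0) t1).
  rewrite !inE => /(_ Xz Xc); congr (X _).
  by rewrite /conv/= /unstable.onem scalerBl scale1r /u scalerBr addrCA addrA.
have := c_min _ Xt.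
rewrite (bregman_three_point phi b c (c + t *: u)).
have := bregman_le_curvature _ _ D_ge0 _ _ cu c t (ltW t0).
rewrite [c + t *: u - c]addrAC subrr add0r.
set D := bregman phi (c + _) c; set D' := bregman phi c b => le1 le2.
have {}le2 : 0 <= w * (D + dot (grad phi c - grad phi b + w^-1 *: a) (t *: u)).
  have E : w * dot (w^-1 *: a) (t *: u) = dot a (t *: u).
    by rewrite dotZl mulrA divff ?mul1r// gt_eqF.
  rewrite dotDl addrA mulrDr E.
  by move: le2; rewrite dotDr; lra.
rewrite pmulr_rge0// in le2.
by move: le2; rewrite !dot_linear; lra.
Qed.

Lemma relint_extend {R : realType} {n : nat} (F : set 'rV[R]_n)
    (c z : 'rV[R]_n) :
  relint F c -> F z -> exists2 t, 0 < t & F (c + t *: (c - z)).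
Proof.
move=> [Fc nF] Fz.
have hull t : affine_hull F (c + t *: (c - z)).
  move=> A [Aaff FA].
  have := Aaff c z (- t) (FA _ Fc) (FA _ Fz); congr (A _).
  by rewrite opprK scalerDl scale1r scaleNr scalerBr addrA.
have cvg : (fun t : R => c + t *: (c - z)) @ (0 : R) --> c + 0 *: (c - z).
  apply: (@cvgD _ _ _ (nbhs (0 : R)) _ (fun=> c)
    (fun t : R => t *: (c - z))).
    exact: cvg_cst.
  by apply: (@cvgZr_tmp _ _ _ (nbhs (0 : R))); exact: cvg_id.
rewrite scale0r addr0 in cvg.
have /nbhs_ballP[e /= e0 be] := cvg _ nF.
exists (e / 2); first by rewrite divr_gt0.
apply: be; last exact: hull.
rewrite /ball/= sub0r normrN gtr0_norm ?divr_gt0//.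
by rewrite ltr_pdivrMr// ltr_pMr// ltr1n.
Qed.

(** The segment from z to c extends beyond c inside F.  Hence p does not
    decrease from c to z, so that z maximizes p over X whenever c does. *)
Lemma normal_on_face {R : realType} {n : nat} (X F : set 'rV[R]_n)
    (c z p : 'rV[R]_n) :
  is_face X F -> relint F c -> F z -> normal_at X c p -> normal_at X z p.
Proof.
move=> [_ FX _] rc Fz np y Xy.
have [t t0 /FX/np] := relint_extend _ _ _ rc Fz.
rewrite [c + _ - c]addrAC subrr add0r dotZr pmulr_rle0// => le1.
by have := np y Xy; move: le1; rewrite !dot_linear; lra.
Qed.

(** The parameters s in U close to inf U give vectors that are normal at z, and
    these converge to the claimed one when tested against a fixed v = y - z.
    Indeed the symmetrized divergence between c s and c (inf U) is at most
    (s - inf U) times a decrease of the linear part a along the path.  Such a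
    decrease is bounded, because a decreases along the whole path; and by
    [bregman_young] a small divergence makes <G(c s) - G(c (inf U)), v>
    small. *)
Lemma central_path_inf_normal {R : realType} {n : nat}
    (phi : 'rV[R]_n -> R) (kappa : R)
    (D_ge0 : forall x y : 'rV[R]_n, 0 <= bregman phi x y)
    (phi_curved : curved phi kappa) (X F : set 'rV[R]_n) (F_face : is_face X F)
    (a p z : 'rV[R]_n) (c : R -> 'rV[R]_n) (U : set R)
    (c_X : forall s, 0 <= s -> X (c s))
    (c_normal : forall s, 0 <= s ->
       normal_at X (c s) (p - s *: a - grad phi (c s)))
    (U_neq0 : U !=set0)
    (U_F : forall s, U s -> 0 <= s /\ relint F (c s)) :
  F z -> normal_at X z (p - inf U *: a - grad phi (c (inf U))).
Proof.
move=> Fz y Xy; set v := y - z; set s0 := inf U.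
have s0_ge0 : 0 <= s0 by apply: lb_le_inf => // s /U_F[].
have hU : has_inf U by split=> //; exists 0 => s /U_F[].
have mono s t : 0 <= s -> s <= t ->
    bregman phi (c s) (c t) + bregman phi (c t) (c s)
      <= (t - s) * (dot a (c s) - dot a (c t)).
  move=> s_ge0 st; have t_ge0 := le_trans s_ge0 st.
  have := c_normal _ s_ge0 _ (c_X _ t_ge0).
  have := c_normal _ t_ge0 _ (c_X _ s_ge0).
  by rewrite bregman_sym !dot_linear; lra.
have [s1 Us1] := U_neq0.
have [s1_ge0 _] := U_F _ Us1.
pose C := `|dot a (c s0) - dot a (c s1)|.
have [mu mu0 cu] := phi_curved v.
apply: (le0_of_quadratic_bound _ (`|dot a v| + C + kappa * mu / 2)).
move=> t /andP[t0 t1].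
(* With s - inf U < t^2 every error term has order t^2 after the inequality
   has been multiplied by t. *)
have [s [Us ss s_lt]] : exists s, [/\ U s, s <= s1 & s < s0 + t ^+ 2].
  have [s Us s_lt] := inf_adherent (exprn_gt0 2 t0) hU.
  have [ss|ss] := leP s s1; first by exists s.
  by exists s1; split=> //; exact: lt_trans s_lt.
have [s_ge0 rs] := U_F _ Us.
have s0s : s0 <= s by apply: ge_inf => //; case: hU.
have E1 : dot (p - s *: a - grad phi (c s)) v <= 0.
  exact: normal_on_face F_face rs Fz (c_normal _ s_ge0) _ Xy.
have E2 : bregman phi (c s0) (c s) <= t ^+ 2 * C.
  have D1 := D_ge0 (c s) (c s0); have := mono _ _ s0_ge0 s0s.
  have acs : dot a (c s1) <= dot a (c s).
    move: ss; rewrite le_eqVlt => /predU1P[->//|ss].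
    have := mono _ _ s_ge0 (ltW ss).
    have := D_ge0 (c s) (c s1); have := D_ge0 (c s1) (c s) => h1 h2 h3.
    rewrite -subr_ge0; have s1s : 0 < s1 - s by rewrite subr_gt0.
    by rewrite -(pmulr_rge0 _ s1s); exact: le_trans (addr_ge0 h2 h1) h3.
  have acC : dot a (c s0) - dot a (c s) <= C.
    by have := ler_norm (dot a (c s0) - dot a (c s1)); rewrite -/C; lra.
  have C0 : 0 <= C by exact: normr_ge0.
  have h1 : (s - s0) * (dot a (c s0) - dot a (c s)) <= (s - s0) * C.
    by rewrite ler_wpM2l// subr_ge0.
  have h2 : (s - s0) * C <= t ^+ 2 * C by rewrite ler_wpM2r//; lra.
  lra.
have E3 := bregman_young _ D_ge0 (c s) (c s0) (t *: v).
have E4 := bregman_le_curvature _ _ D_ge0 _ _ cu (c s0) t (ltW t0).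
have E5 : t * ((s - s0) * dot a v) <= t ^+ 2 * `|dot a v|.
  rewrite expr2 -mulrA ler_pM2l//.
  have h1 : (s - s0) * dot a v <= (s - s0) * `|dot a v|.
    by rewrite ler_wpM2l ?ler_norm// subr_ge0.
  apply: le_trans h1 _; rewrite ler_wpM2r//.
  have : t ^+ 2 <= t by rewrite expr2 ger_pMr.
  lra.
have {}E1 := ler_wpM2l (ltW t0) E1.
clearbody v s0 C; move: E1 E3; rewrite mulr0 !dot_linear => E1 E3. lra.
Qed.

(** * Consequences of expansiveness *)

Lemma closed_singleton {R : realType} {n : nat} (s : 'rV[R]_n) :
  closed [set s].
Proof. exact/accessible_closed_set1/hausdorff_accessible/norm_hausdorff. Qed.

Lemma convex_singleton {R : realType} {n : nat} (s : 'rV[R]_n) :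
  convex_set [set s].
Proof.
move=> x y t; rewrite !inE => -> ->.
exact: (@convmm R (convex_lmodType 'rV[R]_n)).
Qed.

(** The projection onto a singleton does not depend on the projected point. *)
Lemma expansive_shift {R : realType} {n : nat} (phi : 'rV[R]_n -> R)
    (kappa : R) : expansive kappa phi ->
  forall s x d : 'rV[R]_n,
    bregman phi (s + d) s <= kappa * bregman phi x (x + d).
Proof.
move=> phi_exp s x d.
have [|_] := phi_exp [set s] _ (closed_singleton _) (convex_singleton _) x
  (x + d).
  by exists s.
apply; last by split=> // z ->.
rewrite [x + d - x]addrAC subrr add0r; split; first by exists s.
by move=> _ [z -> <-].
Qed.

Lemma expansive_ge0 {R : realType} {n : nat} (phi : 'rV[R]_n -> R)
    (kappa : R) : expansive kappa phi ->
  forall x y : 'rV[R]_n, 0 <= kappa * bregman phi x y.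
Proof.
move=> phi_exp x y.
have [|/(_ 0 0) H _] := phi_exp [set 0] _ (closed_singleton _)
  (convex_singleton _) x y.
  by exists 0.
have D0 : bregman phi 0 0 = 0 by rewrite /bregman !subrr dotC dot0l subr0.
by rewrite D0 in H; apply: H; split=> // z ->.
Qed.

(** Each tangent plane lies above phi, hence is bounded below and so
    horizontal; thus the gradient of phi vanishes, and D(x, y) = phi x - phi y
    has opposite values at (x, y) and (y, x). *)
Lemma bregman_eq0_of_le0 {R : realType} {n : nat} (phi : 'rV[R]_n -> R)
    (phi_ge0 : forall x : 'rV[R]_n, 0 <= phi x)
    (D_le0 : forall x y : 'rV[R]_n, bregman phi x y <= 0)
    (x y : 'rV[R]_n) : bregman phi x y = 0.
Proof.
have grad0 (z v : 'rV[R]_n) : 0 <= dot (grad phi z) v.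
  rewrite leNgt; apply/negP => v0.
  pose t := (phi z + 1) / - dot (grad phi z) v.
  have tE : t * dot (grad phi z) v = - (phi z + 1).
    by rewrite /t; field; rewrite lt_eqF.
  have := D_le0 (z + t *: v) z; have := phi_ge0 (z + t *: v).
  rewrite /bregman [z + _ - z]addrAC subrr add0r dotZr tE; lra.
have {}grad0 (z v : 'rV[R]_n) : dot (grad phi z) v = 0.
  apply: le_anti; rewrite grad0 andbT.
  by have := grad0 z (- v); rewrite dotNr oppr_ge0.
have := D_le0 x y; have := D_le0 y x; rewrite /bregman !grad0; lra.
Qed.

(** * Comparison of the two paths *)

(** All the steps end in the relative interior of F, so that their optimality
    conditions are transported to z, where they telescope. *)
Lemma prox_path_normal {R : realType} {n : nat} (phi : 'rV[R]_n -> R)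
    (X F : set 'rV[R]_n) (F_face : is_face X F) (a : 'rV[R]_n)
    (lam : nat -> R) (xs : nat -> 'rV[R]_n) (l d : nat)
    (xs_F : forall j, (l <= j <= l + d)%N -> relint F (xs j))
    (xs_normal : forall j, (l <= j < l + d)%N ->
       normal_at X (xs j.+1)
         (grad phi (xs j) - (lam j)^-1 *: a - grad phi (xs j.+1)))
    (z : 'rV[R]_n) : F z ->
  normal_at X z (grad phi (xs l) - (\sum_(l <= j < l + d) (lam j)^-1) *: a
              - grad phi (xs (l + d)%N)).
Proof.
move=> Fz y Xy; elim: d xs_F xs_normal => [|d IH] xs_F xs_normal.
  by rewrite addn0 big_geq// scale0r subr0 subrr dot0l.
have le1 : dot (grad phi (xs l) - (\sum_(l <= j < l + d) (lam j)^-1) *: a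
    - grad phi (xs (l + d)%N)) (y - z) <= 0.
  apply: IH => j /andP[lj jd]; [apply: xs_F|apply: xs_normal].
    by rewrite lj addnS leqW.
  by rewrite lj addnS ltnS ltnW.
have rF : relint F (xs (l + d).+1).
  by apply: xs_F; rewrite -addnS leq_addr leqnn.
have := normal_on_face _ _ _ _ _ F_face rF Fz (xs_normal (l + d)%N _) _ Xy.
rewrite leq_addr addnS ltnSn => /(_ isT) le2.
rewrite big_nat_recr ?leq_addr//=.
move: le1 le2; set v := y - z; clearbody v.
by rewrite !dot_linear; lra.
Qed.

Theorem theorem3 (R : realType) (n : nat)
  (X : set 'rV[R]_n) (a0 : 'rV[R]_n) (V : set 'rV[R]_n)
  (g : R -> R) (phi : 'rV[R]_n -> R) (kappa : R)
  (x0 : 'rV[R]_n) (K : nat) (lam : nat -> R)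
  (xs : nat -> 'rV[R]_n) (xcp : R -> 'rV[R]_n)
  (m : nat) (F : 'I_m -> set 'rV[R]_n)
  (klo khi : 'I_m -> nat) (Ups : 'I_m -> set R)
  (X_neq0 : X !=set0) (X_closed : closed X) (X_convex : convex_set X)
  (V_compact : compact V) (V_smooth : smooth_set V)
  (V_strict : strictly_convex_set V) (V_0 : V° 0)
  (g_ge0 : forall t, 0 <= g t)
  (g_legendre : legendre (fun v : 'rV[R]_1 => (g (v 0 0))%:E))
  (g_0 : g 0 = 0) (g'_0 : derive1 g 0 = 0)
  (phi_def : phi = fun x => g (gauge (polar V) x))
  (phi_expansive : expansive kappa phi)
  (x0_X : X x0)
  (lam_gt0 : forall k, 0 < lam k)
  (lam_sum : (\sum_(0 <= k <oo) ((lam k)^-1)%:E)%E = +oo%E)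
  (xs_prox : is_proximal_path X phi a0 x0 lam K xs)
  (xcp_central : is_central_path X phi a0 x0 xcp)
  (F_face : forall i, is_face X (F i))
  (F_distinct : injective F)
  (xs_F : forall k, (k <= K)%N -> exists i, relint (F i) (xs k))
  (xcp_F : forall ups : R, 0 <= ups -> exists i, relint (F i) (xcp ups))
  (K_neq0 : forall i, (klo i <= khi i)%N)
  (K_def : forall i,
     [set k | (klo i <= k <= khi i)%N] =
     [set k | (k <= K)%N /\ relint (F i) (xs k)])
  (Ups_def : forall i,
     Ups i = [set ups | 0 <= ups /\ relint (F i) (xcp ups)])
  (Ups_neq0 : forall i, Ups i !=set0)
  (Ups_itv : forall i, is_interval (Ups i)) :
  forall (i : 'I_m) (k : nat), (klo i + 1 <= k <= khi i)%N ->
    bregman phi (xs k)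
      (xcp (inf (Ups i) + \sum_(klo i <= j < k) (lam j)^-1))
    <= kappa * bregman phi (xcp (inf (Ups i))) (xs (klo i)).
Proof.
move=> i k /andP[kl kh].
have D_shift := expansive_shift _ _ phi_expansive.
have kD_ge0 := expansive_ge0 _ _ phi_expansive.
have [kappa_le0|kappa_gt0] := leP kappa 0.
  have D_le0 (x y : 'rV[R]_n) : bregman phi x y <= 0.
    move: kappa_le0; rewrite le_eqVlt => /predU1P[kappa0|kappa_lt0].
      by have := D_shift y x (x - y); rewrite subrKC kappa0 mul0r.
    by have := kD_ge0 x y; rewrite nmulr_rge0.
  have phi_ge0 (x : 'rV[R]_n) : 0 <= phi x by rewrite phi_def.
  by rewrite !bregman_eq0_of_le0// mulr0.
have D_ge0 (x y : 'rV[R]_n) : 0 <= bregman phi x y.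
  by have := kD_ge0 x y; rewrite pmulr_rge0.
have phi_curved := curvature_exists _ _ kappa_gt0 D_ge0 D_shift.
have cp_X ups : 0 <= ups -> X (xcp ups).
  rewrite le_eqVlt => /predU1P[<-|/(xcp_central.2)[]//].
  by rewrite xcp_central.1.
have cp_normal ups : 0 <= ups ->
    normal_at X (xcp ups) (grad phi x0 - ups *: a0 - grad phi (xcp ups)).
  rewrite le_eqVlt => /predU1P[<-|ups0].
    by move=> z _; rewrite xcp_central.1 scale0r subr0 subrr dot0l.
  rewrite -[X in X *: a0]invrK.
  apply: (argmin_normal _ _ D_ge0 phi_curved _ X_convex).
    by rewrite invr_gt0.
  exact: xcp_central.2.
have xs_i j : (klo i <= j <= khi i)%N -> (j <= K)%N /\ relint (F i) (xs j).
  by move=> jk; have : [set j | (klo i <= j <= khi i)%N] j by []; rewrite K_def.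
have kE : (klo i + (k - klo i) = k)%N by rewrite subnKC// ltnW// -addn1.
have k_i : (klo i <= k <= khi i)%N by rewrite kh andbT -kE leq_addr.
have Fk : F i (xs k) by have [_ []] := xs_i _ k_i.
have k_normal : normal_at X (xs k)
    (grad phi (xs (klo i)) - (\sum_(klo i <= j < k) (lam j)^-1) *: a0
     - grad phi (xs k)).
  have := prox_path_normal phi _ _ (F_face i) a0 lam xs (klo i) (k - klo i).
  rewrite kE; apply => // j /andP[lj jk].
    by have [] := xs_i j; rewrite // lj (leq_trans jk).
  have [jK _] : (j.+1 <= K)%N /\ relint (F i) (xs j.+1).
    by apply: xs_i; rewrite (leqW lj) (leq_trans jk).
  apply: (argmin_normal _ _ D_ge0 phi_curved _ X_convex) => //.
  exact: xs_prox.2.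
set S := \sum_(_ <= j < _) _ in k_normal *.
have S_ge0 : 0 <= S by apply: sumr_ge0 => j _; rewrite invr_ge0 ltW.
have Ups_i s : Ups i s -> 0 <= s /\ relint (F i) (xcp s) by rewrite Ups_def.
have ulo_ge0 : 0 <= inf (Ups i).
  by apply: lb_le_inf => // s /Ups_i[].
have ulo_normal := central_path_inf_normal _ _ D_ge0 phi_curved _ _ (F_face i)
  _ _ _ _ _ cp_X cp_normal (Ups_neq0 i) Ups_i Fk.
have uk_ge0 := addr_ge0 ulo_ge0 S_ge0.
apply: (bregman_dual_shift _ _ kappa_gt0 D_ge0 phi_curved).
have Xk : X (xs k) by have [_ FX _] := F_face i; exact: FX.
have := k_normal _ (cp_X _ uk_ge0).
have := ulo_normal _ (cp_X _ uk_ge0).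
have := cp_normal _ uk_ge0 _ Xk.
by rewrite !dot_linear; lra.
Qed.
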